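(* Let $\alpha: G\curvearrowright X$ be a minimal topologically free residually finite action of a countable discrete group $G$ on the Cantor set $X$. Then the topological full group $[[\alpha]]$ is LEF and thus sofic.
   Context: The topological full group $[[\alpha]]$ is the group of all homeomorphisms $\varphi: X\to X$ for which there is a continuous map $c: X\to G$ ($G$ discrete) with $\varphi(x)=\alpha_{c(x)}(x)$ for all $x\in X$. An action is topologically free if for each $g\neq e$ the fixed-point set of $g$ has empty interior (for countable $G$: equivalently, points with trivial stabilizer are dense). A continuous action $\alpha$ of $G$ on a perfect compact metrizable space $X$ with compatible metric $d$ is residually finite if for any finite $F\subset G$ and $\epsilon>0$ there is a finite set $E\subset X$, equipped with a $G$-action $\beta$, such that $E$ is $\epsilon$-dense in $X$ and $d(\alpha(s)(z),\beta(s)(z))<\epsilon$ for all $z\in E$ and $s\in F$. A group $G$ is LEF (locally embeddable in the class of finite groups) if for any finite $H\subset G$ there is a finite set $K$ with $H\subset K\subset G$ and a binary operation $\odot: K^2\to K$ making $(K,\odot)$ a group such that $h_1\cdot h_2=h_1\odot h_2$ for all $h_1,h_2\in H$. A countable group $\Gamma$ is sofic if for any finite $F\subset\Gamma$ and $\epsilon>0$ there are a finite nonempty set $A$ and a map $\Theta:\Gamma\to \operatorname{Map}(A)$ (all maps $A\to A$) such that $\Theta(e)=\mathrm{id}_A$; $d_H(\Theta(fg),\Theta(f)\Theta(g))\le\epsilon$ whenever $f,g,fg\in F$; and $d_H(\Theta(f),\mathrm{id}_A)>1-\epsilon$ for $e\neq f\in F$. Here $d_H(f,g)=|\{x\in A: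 f(x)\neq g(x)\}|/|A|$. *)

(* Defs.v *)
From HB Require Import structures.
From mathcomp Require Import all_boot all_order all_algebra.
From mathcomp Require Import boolp classical_sets functions cardinality reals.
From mathcomp Require Import topology cantor.

Set Implicit Arguments.
Unset Strict Implicit.
Unset Printing Implicit Defensive.

Import Order.TTheory GRing.Theory Num.Theory.

Local Open Scope classical_set_scope.
Local Open Scope ring_scope.

(* The inverse is a field so that the group structure below is computed; it is
   determined by the underlying map (homeo_inj). *)
Record homeo (X Y : topologicalType) := Homeo {
  homeo_fun :> X -> Y;
  homeo_inv : Y -> X;
  homeoK : cancel homeo_fun homeo_inv;
  homeoVK : cancel homeo_inv homeo_fun;
  homeo_continuous : continuous homeo_fun;
  homeoV_continuous : continuous homeo_inv
}.

Lemma homeo_inj (X Y : topologicalType) (f g : homeo X Y) : f =1 g -> f = g.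
Proof.
case: f g => [f f' fK fVK cf cf'] [g g' gK gVK cg cg'] /= fg.
have efg : f = g by exact/funext.
have efg' : f' = g' by apply/funext => y; rewrite -[y in LHS]gVK -fg fK.
case: _ / efg in gK gVK cg *; case: _ / efg' in gK gVK cg' *.
by congr Homeo; exact: Prop_irrelevance.
Qed.

HB.instance Definition _ (X Y : topologicalType) := gen_eqMixin (homeo X Y).
HB.instance Definition _ (X Y : topologicalType) := gen_choiceMixin (homeo X Y).

Section HomeoGroup.
Variable X : topologicalType.
Implicit Types f g h : homeo X X.

Lemma id_continuous : continuous (@id X).
Proof. by move=> x; exact: cvg_id. Qed.

Definition homeo1 : homeo X X :=
  @Homeo X X id id (fun=> erefl) (fun=> erefl) id_continuous id_continuous.

Definition homeoV f : homeo X X :=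
  Homeo (@homeoVK _ _ f) (@homeoK _ _ f)
        (@homeoV_continuous _ _ f) (@homeo_continuous _ _ f).

Lemma homeoM_continuous f g : continuous (f \o g).
Proof.
by move=> x; apply: continuous_comp; [exact: homeo_continuous|exact: homeo_continuous].
Qed.

Lemma homeoMV_continuous f g : continuous (homeo_inv g \o homeo_inv f).
Proof.
by move=> x; apply: continuous_comp;
  [exact: homeoV_continuous|exact: homeoV_continuous].
Qed.

Definition homeoM f g : homeo X X :=
  Homeo (can_comp (@homeoK _ _ f) (@homeoK _ _ g))
        (can_comp (@homeoVK _ _ g) (@homeoVK _ _ f))
        (homeoM_continuous (f := f) (g := g))
        (homeoMV_continuous (f := f) (g := g)).

Lemma homeoMA : associative homeoM.
Proof. by move=> f g h; exact: homeo_inj. Qed.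

Lemma homeo1M : left_id homeo1 homeoM.
Proof. by move=> f; exact: homeo_inj. Qed.

Lemma homeoM1 : right_id homeo1 homeoM.
Proof. by move=> f; exact: homeo_inj. Qed.

Lemma homeoVM : left_inverse homeo1 homeoV homeoM.
Proof. by move=> f; apply: homeo_inj => x /=; rewrite homeoK. Qed.

Lemma homeoMV : right_inverse homeo1 homeoV homeoM.
Proof. by move=> f; apply: homeo_inj => x /=; rewrite homeoVK. Qed.

HB.instance Definition _ := isGroup.Build (homeo X X)
  homeoMA homeo1M homeoM1 homeoVM homeoMV.

End HomeoGroup.

Definition cantor_set (X : topologicalType) : Prop :=
  inhabited (homeo cantor_space X).

Definition group_action (G : groupType) (T : Type) (a : G -> T -> T) : Prop :=
  (forall x, a 1%g x = x) /\ (forall g h x, a (g * h)%g x = a g (a h x)).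

(* G is discrete, so continuity of an action is continuity of each a g. *)
Record continuous_action (G : groupType) (X : topologicalType) := ContAction {
  act :> G -> X -> X;
  act_group_action : group_action act;
  act_continuous : forall g, continuous (act g)
}.

Section ActionProperties.
Variables (G : groupType) (X : topologicalType).
Implicit Type alpha : continuous_action G X.

Definition minimal_action alpha : Prop :=
  forall A : set X, closed A -> (forall g x, A x -> A (alpha g x)) ->
    A = set0 \/ A = setT.

Definition topologically_free alpha : Prop :=
  forall g : G, g <> 1%g -> interior [set x | alpha g x = x] = set0.

End ActionProperties.

Definition residually_finite_action (R : realType) (G : groupType)
    (X : metricType R) (alpha : continuous_action G X) : Prop :=
  forall (F : set G) (eps : R), finite_set F -> 0 < eps ->
  exists (E : set X) (beta : G -> E -> E),
    [/\ finite_set E, group_action beta,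
        forall x : X, exists2 z : X, E z & mdist x z < eps &
        forall (z : E) (s : G), F s ->
          mdist (alpha s (val z)) (val (beta s z)) < eps].

Section TopologicalFullGroup.
Variables (G : groupType) (X : topologicalType) (alpha : continuous_action G X).

Definition full_group_set : set (homeo X X) :=
  [set phi | exists2 c : X -> discrete_topology G,
     continuous c & forall x, phi x = alpha (c x) x].

Definition full_group_pred : pred (homeo X X) :=
  fun phi => `[< full_group_set phi >].

Lemma full_group_closed : group_closed full_group_pred.
Proof.
have [a1 aM] := act_group_action alpha.
have aV g x y : y = alpha g x -> x = alpha g^-1%g y.
  by move=> ->; rewrite -aM mulVg a1.
split.
  apply/asboolP; exists (fun=> 1%g) => [|x]; first exact: cst_continuous.
  by rewrite a1.
move=> phi psi /asboolP[c cc phiE] /asboolP[d cd psiE]; apply/asboolP.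
exists (fun x => c (homeo_inv psi x) * (d (homeo_inv psi x))^-1)%g => [x|x].
  pose y := homeo_inv psi x.
  have nc (e : X -> discrete_topology G) :
      continuous e -> nbhs y [set z | e z = e y].
    by move=> ce; exact: (ce y _ (discrete_set1 (e y))).
  have Wy : nbhs y [set z | c z = c y /\ d z = d y] by apply: filterI; exact: nc.
  have Wx := @homeoV_continuous _ _ psi x _ Wy.
  move=> U /nbhs_singleton Ux; suff : nbhs x (homeo_inv psi @^-1`
      [set z | U (c z * (d z)^-1)%g]) by [].
  by apply: filterS Wx => z /= [-> ->].
rewrite aM -(aV _ (homeo_inv psi x)) -?psiE ?homeoVK//.
by rewrite -phiE.
Qed.

Definition full_group : Type := {phi : homeo X X | full_group_pred phi}.

HB.instance Definition _ := SubChoice.on full_group.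
HB.instance Definition _ :=
  SubChoice_isSubGroup.Build (homeo X X) full_group_pred full_group
    full_group_closed.

End TopologicalFullGroup.

Definition group_law (T : Type) (op : T -> T -> T) : Prop :=
  associative op /\
  exists e : T, [/\ left_id e op, right_id e op &
    forall x, exists y, op y x = e /\ op x y = e].

Definition LEF (L : groupType) : Prop :=
  forall H : set L, finite_set H ->
  exists (K : set L) (op : K -> K -> K),
    [/\ finite_set K, H `<=` K, group_law op &
        forall h1 h2 : K, H (val h1) -> H (val h2) ->
          (val h1 * val h2)%g = val (op h1 h2)].

Definition hamming_dist (R : realType) (A : finType) (f g : A -> A) : R :=
  #|[pred x | f x != g x]|%:R / #|A|%:R.

(* Soficity is a notion for countable groups, hence the first conjunct. *)
Definition sofic (R : realType) (L : groupType) : Prop :=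
  countable [set: L] /\
  forall (F : set L) (eps : R), finite_set F -> 0 < eps ->
  exists (A : finType) (Theta : L -> A -> A),
    [/\ (0 < #|A|)%N, Theta 1%g =1 id,
        forall f g, F f -> F g -> F (f * g)%g ->
          hamming_dist R (Theta (f * g)%g) (Theta f \o Theta g) <= eps &
        forall f, F f -> f <> 1%g -> 1 - eps < hamming_dist R (Theta f) id].

(* Main.v *)
Require Import Defs.
From mathcomp Require Import all_boot all_order all_algebra.
From mathcomp Require Import classical_sets cardinality reals topology.
From mathcomp Require Import finmap fingroup perm boolp cantor lra.

Set Implicit Arguments.
Unset Strict Implicit.
Unset Printing Implicit Defensive.

Import Order.TTheory GRing.Theory Num.Theory.

Local Open Scope classical_set_scope.

(** An element f of the full group acts as x |-> alpha (c_f x) x for a locally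
    constant cocycle c_f : X -> G.  Topological freeness makes c_f unique, for
    two elements of G that agree on a nonempty open set are equal; hence the
    cocycle identity c_(fg) x = c_f (g x) * c_g x ([cocycleM]).

    By compactness, each c_f is constant on all sets of small enough diameter
    and takes finitely many values.  So take a finite model (T, b) of alpha, with
    T -> X finely dense, that approximates finely all the values of the cocycles
    in play.  On T, f becomes the map phi f : t |-> b (c_f t) t.  The point
    phi g t is close to g t, so c_f takes the same value at both, and the cocycle
    identity gives phi (f g) t = phi f (phi g t) exactly, not approximately.
    Applied to f and f^-1, this also shows that phi f is a permutation of T.  If
    f and g are distinct, they differ by a definite amount near some point of X,
    hence at some point of T that is close to it, so phi f and phi g are
    distinct.  This maps any finite part of the full group injectively and
    multiplicatively to a finite symmetric group
    ([full_group_locally_finite_embeddable]).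

    Such maps give LEF: the finite group is transported to a subset of the full
    group that contains the given part, with additional elements as labels.  They
    also give soficity: the finite group acts on itself by left translations,
    where nontrivial elements have no fixed point, so Hamming distances are 0 or
    1.  Countability holds because a cocycle is determined by its values on a
    finite net. *)

(** * Maps to finite groups, LEF and soficity *)

(** The form of LEF that constructions deliver, with a finite group unrelated to
    the elements of L.  Multiplicativity bears on products of elements of F
    that may leave F, while injectivity bears on F alone: F must be enlarged when
    products are to be told apart. *)
Definition locally_finite_embeddable (L : groupType) : Prop :=
  forall F : set L, finite_set F -> exists (Q : finGroupType) (pi : L -> Q),
    {in F &, injective pi} /\
    forall f g, F f -> F g -> pi (f * g)%g = (pi f * pi g)%g.

Lemma group_law_transport (Q : groupType) (K : Type) (e : Q -> K) (r : K -> Q) :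
  cancel e r -> cancel r e -> group_law (fun x y => e (r x * r y)%g).
Proof.
move=> eK rK; split; first by move=> x y z; rewrite !eK mulgA.
exists (e 1%g); split=> [x|x|x]; rewrite ?eK ?mul1g ?mulg1 ?rK//.
by exists (e (r x)^-1%g); rewrite !eK mulVg mulgV.
Qed.

(** The fibres of pi over pi(F) dictate j there; the other elements of Q are
    labelled by distinct elements of the infinite complement of F. *)
Lemma extend_section (L : choiceType) (x0 : L) (Q : finType) (pi : L -> Q)
    (F : set L) :
  infinite_set [set: L] -> finite_set F -> {in F &, injective pi} ->
  exists2 j : Q -> L, injective j & forall h, F h -> j (pi h) = h.
Proof.
move=> Linf Ffin piI.
have [B BF sB] := infinite_set_fset #|Q| (infinite_setD Linf Ffin).
pose u (q : Q) := nth x0 (enum_fset B) (enum_rank q).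
have rank_lt (q : Q) : (enum_rank q < size (enum_fset B))%N.
  exact: leq_trans (ltn_ord _) sB.
have uB q : u q \in B by apply: mem_nth; exact: rank_lt.
have uF q : ~ F (u q) by have /BF[] := uB q.
have uI : injective u.
  move=> p q /eqP; rewrite nth_uniq ?rank_lt ?fset_uniq//.
  by move=> /eqP/val_inj/enum_rank_inj.
have jP q : exists x, (exists2 h, F h & pi h = q /\ x = h) \/
    (~ (exists2 h, F h & pi h = q) /\ x = u q).
  have [[h Fh hq]|nh] := pselect (exists2 h, F h & pi h = q).
    by exists h; left; exists h.
  by exists (u q); right.
have [j jE] := choice jP; exists j => [p q|h Fh].
  have [[h Fh [<- ->]]|[_ ->]] := jE p; have [[k Fk [<- ->]]|[_ ->]] := jE q.
  - by move=> ->.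
  - by move=> hu; case: (uF q); rewrite -hu.
  - by move=> uk; case: (uF p); rewrite uk.
  - exact: uI.
case: (jE (pi h)) => [[k Fk [/piI + ->]]|[[]]]; last by exists h.
by apply; exact: mem_set.
Qed.

(** The underlying set of the finite group has to be a subset of L, which must
    therefore have room for it: a finite L serves as its own K. *)
Lemma locally_finite_embeddable_LEF (L : groupType) :
  locally_finite_embeddable L -> LEF L.
Proof.
move=> LE H Hfin.
suff [K [Q [e [r [eK rK Kfin HK mulE]]]]] : exists (K : set L) (Q : groupType)
    (e : Q -> K) (r : K -> Q), [/\ cancel e r, cancel r e, finite_set K,
    H `<=` K & forall h k : K, H (val h) -> H (val k) ->
      (val h * val k)%g = val (e (r h * r k)%g)].
  exists K, (fun x y => e (r x * r y)%g); split=> //.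
  exact: group_law_transport.
have [Lfin|Linf] := pselect (finite_set [set: L]).
  exists setT, L, (fun x => SigSub (mem_set (I : [set: L] x))), val.
  by split=> // x; exact: val_inj.
(* The product of h and k must be the element j (pi (h * k)) of K, so j has to
   invert pi on H * H as well. *)
pose F := H `|` [set (f * g)%g | f in H & g in H].
have Ffin : finite_set F.
  by rewrite /F finite_setU; split=> //; exact: finite_image2.
have HF : H `<=` F by move=> h; left.
have [Q [pi [piI piM]]] := LE F Ffin.
have [j jI jK] := extend_section 1%g Linf Ffin piI.
pose e q : range j := SigSub (mem_set (imageT j q)).
have eI : injective e by move=> p q /(congr1 val)/jI.
have e_onto k : exists q, e q = k.
  by have /set_mem[q _ qk] := valP k; exists q; exact: val_inj.
have [r rK] := choice e_onto.
exists (range j), Q, e, r; split=> //.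
- by move=> q; apply: eI; rewrite rK.
- exact: finite_image.
- by move=> h Hh; exists (pi h) => //; rewrite jK//; exact: HF.
move=> h k Hh Hk /=.
have rE x : H (val x) -> r x = pi (val x).
  by move=> Hx; apply: jI; rewrite jK; [rewrite -[in RHS](rK x)|exact: HF].
rewrite !rE// -piM; do ?exact: HF.
by rewrite jK//; right; exists (val h) => //; exists (val k).
Qed.

(** The left regular action of the finite group is free, so a nontrivial element
    of F moves every point. *)
Lemma locally_finite_embeddable_sofic (R : realType) (L : groupType) :
  countable [set: L] -> locally_finite_embeddable L -> sofic R L.
Proof.
move=> Lc LE; split=> // F eps Ffin eps0.
(* With 1 in the finite part, pi 1 is idempotent and thus trivial, and injectivity
   keeps the other elements of F away from it. *)
have [|Q [pi [piI piM]]] := LE (F `|` [set 1%g]); first by rewrite finite_setU.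
have pi1 : pi 1%g = 1%g.
  by apply: (mulgI (pi 1%g)); rewrite -piM ?mulg1//; right.
exists Q, (fun f q => (pi f * q)%g); split.
- by apply/card_gt0P; exists 1%g.
- by move=> q; rewrite pi1 mul1g.
- move=> f g Ff Fg _; rewrite /hamming_dist eq_card0 ?mul0r ?ltW// => q.
  by rewrite !inE/= piM ?mulgA ?eqxx//; left.
move=> f Ff f1; have piNfix q : (pi f * q)%g != q.
  apply/eqP => fq; apply: f1; apply: piI.
  - by apply: mem_set; left.
  - by apply: mem_set; right.
  - by rewrite pi1; apply: (mulIg q); rewrite fq mul1g.
rewrite /hamming_dist eq_cardT => [|q]; last exact: piNfix.
rewrite -cardT divff ?ltrBlDr ?ltrDl// pnatr_eq0 -lt0n.
by apply/card_gt0P; exists 1%g.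
Qed.

Local Open Scope ring_scope.

(** * Locally constant functions on a compact metric space *)

Lemma finite_set_near (T I : Type) (F : set I) (U : set_system T)
    (P : I -> T -> Prop) :
  Filter U -> finite_set F -> (forall i, F i -> \forall x \near U, P i x) ->
  \forall x \near U, forall i, F i -> P i x.
Proof.
elim/Pchoice: I => I in F P *.
move=> FU /finite_fsetP[D ->] FP.
have := @filter_bigI _ _ D (fun i => [set x | P i x]) U FU FP.
by apply: filterS => x Px i /Px.
Qed.

Lemma near0_right_ex (R : realType) (P : R -> Prop) :
  (\forall r \near 0^'+, P r) -> exists2 r, 0 < r & P r.
Proof.
move=> nP; have nP0 : \forall r \near (0 : R)^'+, 0 < r /\ P r.
  by apply: filterI nP; exact: nbhs_right_gt.
by have [r [r0 Pr]] := @filter_ex _ _ (at_right_proper_filter 0) _ nP0; exists r.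
Qed.

Section LocallyConstant.
Context {R : realType} {X : metricType R} {T : Type}.
Implicit Type c : X -> T.

Definition locally_constant c := forall x, \forall y \near x, c y = c x.

Definition constant_at_scale (r : R) c :=
  forall x y, mdist x y < r -> c x = c y.

(** Lebesgue numbers, from the characterization of compactness by near
    coverings: if c is constant on the ball of radius e around x, then scales
    below e / 2 are fine for all the points at distance less than e / 2 of x. *)
Lemma locally_constant_scale c :
  compact [set: X] -> locally_constant c ->
  \forall r \near 0^'+, constant_at_scale r c.
Proof.
move=> /compact_near_coveringP X_cover c_lc.
pose P r x := forall y, mdist x y < r -> c x = c y.
suff /X_cover : forall x, [set: X] x ->
    \forall x' \near x & r \near 0^'+, P r x'.
  by apply: filterS => r rP x y; exact: rP.
move=> x _; have /nbhs_ballP[e /= e0 xc] := c_lc x.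
have e20 : 0 < e / 2 by rewrite divr_gt0.
near=> y r => z yz.
have xy : ball x (e / 2) y by near: y; exact: nbhsx_ballx.
have re : r < e / 2 by near: r; exact: nbhs_right_lt.
rewrite xc; last by apply: le_ball xy; rewrite [leRHS]splitr lerDl ltW.
rewrite xc// [e]splitr; apply: ball_triangle xy _.
by rewrite ballEmdist/=; exact: lt_trans yz re.
Unshelve. all: by end_near. Qed.

End LocallyConstant.

(** * Finite models of the action *)

Section FullGroup.
Variables (R : realType) (G : groupType) (X : metricType R).
Variable alpha : continuous_action G X.
Local Notation L := (full_group alpha).

(** Residual finiteness with a finite type of labels for the points of X instead
    of a finite subset of X, so that permutations of the model form a finite
    group. *)
Lemma finite_model (F : set G) (eps : R) :
  residually_finite_action alpha -> finite_set F -> 0 < eps ->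
  exists (T : finType) (p : T -> X) (b : G -> T -> T),
    [/\ group_action b, forall x, exists t, mdist x (p t) < eps &
        forall t s, F s -> mdist (alpha s (p t)) (p (b s t)) < eps].
Proof.
move=> rf Ffin eps0.
have [E [beta [Efin [b1 bM] Edense balpha]]] := rf F eps Ffin eps0.
have inT z : E z -> z \in fset_set E by rewrite in_fset_set// => /mem_set.
have inE' (t : fset_set E) : val t \in E.
  by have := valP t; rewrite in_fset_set.
pose i (t : fset_set E) : E := SigSub (inE' t).
pose k (z : E) : fset_set E := FSetSub (inT _ (set_mem (valP z))).
have iK : cancel i k by move=> t; exact: val_inj.
have kK : cancel k i by move=> z; exact: val_inj.
exists (fset_set E), val, (fun s t => k (beta s (i t))); split.
- by split=> [t|g h t]; rewrite ?b1 ?bM ?kK ?iK.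
- move=> x; have [z Ez xz] := Edense x.
  by exists (FSetSub (inT _ Ez)).
- by move=> t s Fs; have := balpha (i t) s Fs.
Qed.

(** * Cocycles of the elements of the full group *)

Lemma cocycle_exists (f : L) : exists c : X -> G,
  locally_constant c /\ forall x, val f x = alpha (c x) x.
Proof.
have /asboolP[c cc cE] := valP f; exists c; split=> // x.
exact: (cc x _ (discrete_set1 (c x))).
Qed.

Definition cocycle (f : L) : X -> G := sval (cid (cocycle_exists f)).

Lemma cocycle_locally_constant (f : L) : locally_constant (cocycle f).
Proof. by rewrite /cocycle; case: cid => c []. Qed.

Lemma cocycleE (f : L) x : val f x = alpha (cocycle f x) x.
Proof. by rewrite /cocycle; case: cid => c []. Qed.

Lemma cocycle_inj : injective cocycle.
Proof.
by move=> f g fg; apply/val_inj/homeo_inj => x; rewrite !cocycleE fg.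
Qed.

Hypothesis alpha_free : topologically_free alpha.

(** Near x both cocycles are constant, so (d x)^-1 * c x fixes a neighbourhood of
    x pointwise, and freeness makes it trivial. *)
Lemma cocycle_unique (c d : X -> G) :
  locally_constant c -> locally_constant d ->
  (forall x, alpha (c x) x = alpha (d x) x) -> c =1 d.
Proof.
have [a1 aM] := act_group_action alpha.
move=> c_lc d_lc cd x; apply: contrapT => cdx.
have /alpha_free : ((d x)^-1 * c x)%g <> 1%g.
  by move=> /(congr1 (fun z => d x * z)%g); rewrite mulKVg mulg1.
move/seteqP => [/(_ x) + _]; apply.
apply: filterS (filterI (c_lc x) (d_lc x)) => y /= [cy dy].
by rewrite aM -cy cd dy -aM mulVg a1.
Qed.

Lemma cocycle1 x : cocycle 1%g x = 1%g.
Proof.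
have [a1 aM] := act_group_action alpha; move: x.
apply: cocycle_unique; first exact: cocycle_locally_constant.
  by move=> x; exact: nearW.
by move=> x; rewrite -cocycleE a1.
Qed.

Lemma cocycleM (f g : L) x :
  cocycle (f * g)%g x = (cocycle f (val g x) * cocycle g x)%g.
Proof.
have [a1 aM] := act_group_action alpha; move: x.
apply: cocycle_unique; first exact: cocycle_locally_constant.
  move=> x; have fgx : \forall y \near x,
      cocycle f (val g y) = cocycle f (val g x).
    exact: (@homeo_continuous _ _ (val g) x _
      (cocycle_locally_constant f (val g x))).
  by apply: filterS2 fgx (cocycle_locally_constant g x) => y -> ->.
by move=> x; rewrite aM -!cocycleE.
Qed.

(** * Finite permutation models of the full group *)

Hypothesis X_compact : compact [set: X].
Hypothesis alpha_rf : residually_finite_action alpha.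

Lemma finite_net (eps : R) : 0 < eps ->
  exists s : seq X, forall x, exists2 z, z \in s & mdist x z < eps.
Proof.
move=> eps0; have [T [p [_ [_ net _]]]] := finite_model alpha_rf (finite_set0 G) eps0.
exists [seq p t | t : T] => x; have [t xt] := net x.
by exists (p t) => //; apply: map_f; rewrite mem_enum.
Qed.

Lemma cocycle_scale (f : L) : \forall r \near 0^'+, constant_at_scale r (cocycle f).
Proof. exact: locally_constant_scale (cocycle_locally_constant f). Qed.

Lemma finite_cocycle_range (f : L) : finite_set (range (cocycle f)).
Proof.
have [r r0 fr] := near0_right_ex (cocycle_scale f).
have [s net] := finite_net r0.
apply: (@sub_finite_set _ _ (cocycle f @` [set` s])); last first.
  by apply: finite_image; exact: finite_seq.
by move=> _ [x _ <-]; have [z zs /fr->] := net x; exists z.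
Qed.

(** If f x and g x are at distance 3 D > 0, then continuity keeps f y and g y
    more than D apart for y near x. *)
Lemma full_group_separation (f g : L) : f <> g ->
  \forall r \near 0^'+, exists x : X, forall y, mdist x y < r ->
    r < mdist (val f y) (val g y).
Proof.
move=> fg.
have [x fgx] : exists x, val f x <> val g x.
  by apply/existsNP => fg1; apply: fg; apply/val_inj/homeo_inj.
pose D := mdist (val f x) (val g x) / 3.
have D0 : 0 < D by rewrite divr_gt0// mdist_gt0; exact/eqP.
have near_x (h : L) : \forall y \near x, mdist (val h x) (val h y) < D.
  have := @homeo_continuous _ _ (val h) x _ (nbhsx_ballx _ _ D0).
  by rewrite ballEmdist.
have [e /= e0 xe] := (nbhs_ballP _ _).1 (filterI (near_x f) (near_x g)).
near=> r; exists x => y xy.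
have re : r < e by near: r; exact: nbhs_right_lt.
have rD : r < D by near: r; exact: nbhs_right_lt.
have [|fy gy] := xe y; first by rewrite ballEmdist/=; exact: lt_trans xy re.
apply: lt_trans rD _; rewrite ltNge; apply/negP => fgy.
have : mdist (val f x) (val g x) < D + (D + D).
  apply: le_lt_trans (metric_triangle _ (val f y) _) _; apply: ltrD => //.
  apply: le_lt_trans (metric_triangle _ (val g y) _) _.
  by rewrite [mdist (val g y) _]metric_sym; exact: ler_ltD.
by rewrite /D; lra.
Unshelve. all: by end_near. Qed.

(** The scale r is fine enough for the cocycles of F and of its inverses, and for
    telling apart the elements of F.  A model of precision r / 2 suffices: if
    phi f t = phi g t, then f t and g t are both at distance less than r / 2 of
    this common image. *)
Lemma full_group_locally_finite_embeddable : locally_finite_embeddable L.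
Proof.
move=> F Ffin; pose S := F `|` [set f^-1%g | f in F].
have Sfin : finite_set S by rewrite finite_setU; split=> //; exact: finite_image.
have FS : F `<=` S by move=> f; left.
have Sscale : \forall r \near (0 : R)^'+,
    forall f, S f -> constant_at_scale r (cocycle f).
  by apply: finite_set_near Sfin _ => f _; exact: cocycle_scale.
have Fsep : \forall r \near (0 : R)^'+, forall fg : L * L, (F `*` F) fg ->
    fg.1 <> fg.2 -> exists x, forall y, mdist x y < r ->
      r < mdist (val fg.1 y) (val fg.2 y).
  apply: finite_set_near (finite_setX Ffin Ffin) _ => -[f g] _ /=.
  have [->|fg] := pselect (f = g); first by near=> r; case.
  by apply: filterS (full_group_separation fg) => r xP _.
have [r r0 [Sr Fr]] := near0_right_ex (filterI Sscale Fsep).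
have r20 : 0 < r / 2 by rewrite divr_gt0.
have r2r : r / 2 < r by rewrite ltr_pdivrMr// ltr_pMr// ltr1n.
have Vfin : finite_set (\bigcup_(f in S) range (cocycle f)).
  by apply: bigcup_finite => // f _; exact: finite_cocycle_range.
have [T [p [b [[b1 bM] net pb]]]] := finite_model alpha_rf Vfin r20.
pose phi (f : L) t := b (cocycle f (p t)) t.
have phi_close f t : S f -> mdist (val f (p t)) (p (phi f t)) < r / 2.
  by move=> Sf; rewrite cocycleE; apply: pb; exists f.
have phiM f g t : S f -> S g -> phi (f * g)%g t = phi f (phi g t).
  move=> Sf Sg; rewrite {1}/phi cocycleM bM /phi; congr (b _ _).
  by apply: Sr => //; exact: lt_trans (phi_close g t Sg) r2r.
have phi1 t : phi 1%g t = t by rewrite /phi cocycle1 b1.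
have phiI f : F f -> injective (phi f).
  move=> Ff; apply: (can_inj (g := phi f^-1%g)) => t.
  by rewrite -phiM ?mulVg//; [right; exists f|exact: FS].
(* Permutations compose from left to right, homeomorphisms from right to left;
   the inverse restores the order of products. *)
pose pi (f : L) : {perm T} :=
  if pselect (injective (phi f)) is left fI then (perm fI)^-1%g else 1%g.
have piE f : injective (phi f) -> (pi f)^-1%g =1 phi f.
  by rewrite /pi => fI t; case: pselect => // fI'; rewrite invgK permE.
exists {perm T}, pi; split.
  move=> f g /set_mem Ff /set_mem Fg fg; apply: contrapT => nfg.
  have [x xP] := Fr (f, g) (conj Ff Fg) nfg.
  have [t xt] := net x.
  have fgt : phi f t = phi g t by rewrite -!piE ?fg//; exact: phiI.
  have /lt_trans/(_ (xP (p t) (lt_trans xt r2r))) :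
      mdist (val f (p t)) (val g (p t)) < r.
    apply: le_lt_trans (metric_triangle _ (p (phi f t)) _) _.
    rewrite [ltRHS]splitr; apply: ltrD; first by apply: phi_close; exact: FS.
    by rewrite fgt metric_sym; apply: phi_close; exact: FS.
  by rewrite ltxx.
move=> f g Ff Fg.
have fgE : phi (f * g)%g =1 phi f \o phi g.
  by move=> t; rewrite phiM//; exact: FS.
have fgI : injective (phi (f * g)%g).
  by move=> s t; rewrite !fgE => /phiI-/(_ Ff)/phiI-/(_ Fg).
apply: invg_inj; apply/permP => t.
by rewrite invgM permM !piE//; exact: phiI.
Unshelve. all: by end_near. Qed.

(** An element f is encoded by an integer n such that its cocycle is constant at
    scale 1 / (n + 1), together with the values of that cocycle on a fixed finite
    net of this mesh. *)
Lemma full_group_countable : countable [set: G] -> countable [set: L].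
Proof.
move=> /countable_injP[code codeI].
have net n : exists s : seq X,
    forall x, exists2 z, z \in s & mdist x z < n.+1%:R^-1.
  by apply: finite_net; rewrite invr_gt0.
have [s sP] := choice net.
have scale (f : L) : exists n, constant_at_scale n.+1%:R^-1 (cocycle f).
  have [r r0 fr] := near0_right_ex (cocycle_scale f).
  exists (Num.truncn r^-1) => x y xy; apply: fr; apply: lt_trans xy _.
  by rewrite invf_plt ?posrE// truncnS_gt.
have [n nP] := choice scale.
pose h f := (n f, [seq code (cocycle f z) | z <- s (n f)]).
apply/countable_injP; exists (choice.pickle \o h) => f g _ _.
move=> /(pcan_inj choice.pickleK)[nfg hfg]; apply: cocycle_inj; apply/funext => x.
have [z zs xz] := sP (n f) x.
rewrite (nP f x z xz); rewrite nfg in zs xz hfg.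
rewrite (nP g x z xz); apply: codeI; do ?exact: mem_set.
by move/eq_in_map : hfg; apply.
Qed.

End FullGroup.

Lemma cantor_set_compact (X : topologicalType) :
  cantor_set X -> compact [set: X].
Proof.
move=> [h]; have -> : [set: X] = h @` [set: cantor_space].
  by apply/seteqP; split=> // x _; exists (homeo_inv h x) => //; exact: homeoVK.
apply: continuous_compact; last exact: cantor_space_compact.
by apply: continuous_subspaceT; exact: homeo_continuous.
Qed.

Local Close Scope ring_scope.

Theorem theoremC (R : realType) (G : groupType) (X : metricType R)
    (alpha : continuous_action G X) :
  countable [set: G] ->
  cantor_set X ->
  minimal_action alpha ->
  topologically_free alpha ->
  residually_finite_action alpha ->
  LEF (full_group alpha) /\ sofic R (full_group alpha).
Proof.
move=> G_countable /cantor_set_compact X_compact _ free rf.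
have L_emb := full_group_locally_finite_embeddable free X_compact rf.
split; first exact: locally_finite_embeddable_LEF.
apply: locally_finite_embeddable_sofic L_emb.
exact: full_group_countable.
Qed.
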